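(* Let $G(V,E)$ be a network (a finite undirected graph) with $n=|V|\ge 2$ nodes, and let $p>0$ and $q>0$ be the costs of one communication step and one computation step. Among all grids, of any dimension $k\ge 1$, onto which $G(V,E)$ can be mapped, the best performance (that is, the minimum total cost $S$) of the PSTS algorithm is achieved on a grid of dimension $\lceil \log_2 n\rceil$. Explicitly: there exists a $\lceil \log_2 n\rceil$-dimensional grid with side lengths $m_1,\dots,m_{\lceil \log_2 n\rceil}\ge 2$ onto which $G(V,E)$ can be mapped, such that for every $k\ge 1$ and every $k$-dimensional grid with side lengths $n_1,\dots,n_k\ge 2$ onto which $G(V,E)$ can be mapped, $S(m_1,\dots,m_{\lceil \log_2 n\rceil})\le S(n_1,\dots,n_k)$.
   Context: A $k$-dimensional grid (hyper-grid) with integer side lengths $n_1,\dots,n_k\ge 2$ has $n_1 n_2\cdots n_k$ positions. A network $G(V,E)$ with $n$ nodes can be mapped onto such a grid if its nodes can be placed injectively at grid positions, i.e. if $n_1 n_2\cdots n_k\ge n$. Grid positions not assigned to a node of $V$ are ''virtual nodes'', treated as nodes with zero processing power. Grid links not corresponding to an element of $E$ are ''virtual links'', treated as links of zero bandwidth. Virtual nodes and links are allowed, so no condition on $E$ is imposed. PSTS (Positional Scan Task Scheduling) is a task-scheduling algorithm which balances load along the grid dimension by dimension. Along a line of $m$ nodes it takes $2(m-1)$ communication steps and $2(m-1)$ computation steps, and all lines in the same dimension are processed in parallel. Its total cost on a $k$-dimensional grid with side lengths $n_1,\dots,n_k$, counting virtual nodes as nodes, is therefore defined to be $$S(n_1,\dots,n_k)=2\,(n_1+n_2+\cdots+n_k-k)\,(p+q),$$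 where $p$ and $q$ are the costs in time units of a communication step and a computation step respectively. *)

(* Defs.v *)
From HB Require Import structures.
From mathcomp Require Import all_boot all_order all_algebra.
From mathcomp Require Import reals exp.

Set Implicit Arguments.
Unset Strict Implicit.
Unset Printing Implicit Defensive.

Import Order.TTheory GRing.Theory Num.Theory.

Local Open Scope ring_scope.

Record network := Network {
  node :> finType;
  link : rel node;
  link_sym : symmetric link }.

Record grid (k : nat) := Grid {
  side :> 'I_k -> nat;
  side_ge2 : forall i, (2 <= side i)%N }.

Definition position (k : nat) (g : grid k) : finType :=
  {dffun forall i : 'I_k, 'I_(g i)}.

(* Positions outside the image of the placement are the virtual nodes. Since
   virtual links are allowed as well, [link G] is not constrained. *)
Definition mappable (G : network) (k : nat) (g : grid k) : Prop :=
  exists f : G -> position g, injective f.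

(* The subtraction is taken in R, hence is not truncated. *)
Definition psts_cost (R : realType) (p q : R) (k : nat) (g : grid k) : R :=
  2 * (\sum_(i < k) (g i)%:R - k%:R) * (p + q).

(* The ceiling is an [int]; it is nonnegative for 0 < n (see [ceil_log2E]), so
   that taking [absz] is then a mere change of type. *)
Definition ceil_log2 (R : realType) (n : nat) : nat :=
  `|Num.ceil (ln (n%:R : R) / ln 2)|%N.

Lemma ceil_log2E (R : realType) (n : nat) : (0 < n)%N ->
  (ceil_log2 R n)%:Z = Num.ceil (ln (n%:R : R) / ln 2).
Proof.
move=> n_gt0; rewrite /ceil_log2 gez0_abs// ceil_ge0.
by rewrite (lt_le_trans (ltrN10 _))// divr_ge0// ln_ge0 ?ler1n.
Qed.

(* Main.v *)
(** A side of length [a] costs [a - 1] and contributes a factor [a <= 2 ^ (a - 1)]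
    to the number of positions, so a grid with at least [n] positions satisfies
    [n <= 2 ^ \sum_i (n_i - 1)]; the hypercube with sides 2 attains the resulting
    bound [ceil (log2 n) <= \sum_i (n_i - 1)]. *)
Require Import Defs.
From mathcomp Require Import all_boot all_order all_algebra.
From mathcomp Require Import reals exp.

Import Order.TTheory GRing.Theory Num.Theory.

Local Open Scope ring_scope.

(** A ceiling is at most an integer iff its argument is, and [ln] is increasing; this moves the
    problem from reals to naturals. *)
Lemma ceil_log2_le (R : realType) (n s : nat) : (0 < n)%N ->
  (ceil_log2 R n <= s)%N = (n <= 2 ^ s)%N.
Proof.
move=> n_gt0; rewrite -lez_nat ceil_log2E// ceil_le_int.
rewrite ler_pdivrMr ?ln_gt0 ?ltr1n//.
rewrite -[s%:~R]/(s%:R : R) mulr_natl -lnXn ?ltr0n//.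
by rewrite ler_ln ?posrE ?exprn_gt0 ?ltr0n// -natrX ler_nat.
Qed.

Lemma card_position (k : nat) (g : grid k) :
  #|position g| = (\prod_(i < k) g i)%N.
Proof.
rewrite card_dep_ffun foldrE big_image /=.
by apply: eq_bigr => i _; rewrite card_ord.
Qed.

Lemma mappableP (G : network) (k : nat) (g : grid k) :
  mappable G g <-> (#|G| <= \prod_(i < k) g i)%N.
Proof.
rewrite -card_position; split=> [[f /leq_card//]|le_card].
(* The placement sends the i-th node to the i-th position. *)
exists (fun x => enum_val (widen_ord le_card (enum_rank x))) => x y.
by move=> /enum_val_inj/(congr1 val)/= /val_inj/enum_rank_inj.
Qed.

Lemma prod_side_le (k : nat) (g : grid k) :
  (\prod_(i < k) g i <= 2 ^ \sum_(i < k) (g i).-1)%N.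
Proof.
rewrite expn_sum; apply: leq_prod => i _.
(* For a side [b.+1] the claim is [b < 2 ^ b]. *)
by rewrite -(ltn_predK (side_ge2 g i)) /= ltn_expl.
Qed.

(** Sides are positive, so [.-1] does not truncate and [k] splits as one unit per side. *)
Lemma psts_costE (R : realType) (p q : R) (k : nat) (g : grid k) :
  psts_cost p q g = 2 * (\sum_(i < k) (g i).-1)%:R * (p + q).
Proof.
rewrite /psts_cost natr_sum -[in k%:R](card_ord k) -sumr_const -sumrB.
congr (_ * _ * _); apply: eq_bigr => i _.
by rewrite -[in LHS](ltn_predK (side_ge2 g i)) -natr1 addrK.
Qed.

Definition hypercube (k : nat) : grid k := @Grid k (fun=> 2%N) (fun=> leqnn 2).

Theorem proposition4p1 (R : realType) (G : network) (p q : R)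
    (n_ge2 : (2 <= #|G|)%N) (p_gt0 : 0 < p) (q_gt0 : 0 < q) :
  exists m : grid (ceil_log2 R #|G|),
    mappable G m /\
    forall (k : nat) (g : grid k), (1 <= k)%N -> mappable G g ->
      psts_cost p q m <= psts_cost p q g.
Proof.
have n_gt0 : (0 < #|G|)%N by exact: ltnW.
exists (hypercube _); split.
  by apply/mappableP; rewrite prod_nat_const card_ord -(ceil_log2_le R).
move=> k g _ /mappableP le_prod; rewrite !psts_costE.
rewrite ler_pM2r ?addr_gt0// ler_pM2l ?ltr0n// ler_nat.
(* Each side 2 contributes 1, so the hypercube's sum is its dimension. *)
rewrite sum_nat_const card_ord muln1 ceil_log2_le//.
exact: leq_trans le_prod (prod_side_le k g).
Qed.
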